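(* Let $M\ge 1$ and $T\ge 1$ be integers, and let $\mathcal V=\bigcup_{n}\mathcal V_n$ be a template. (i) If $\mathcal V$ is closed under addition, then the $T$-sum lift is valid with respect to $\mathcal V$: for every path-complete graph $\mathcal G$ on $\langle M\rangle$ satisfying the standing assumption, $\mathcal G\le_{\mathcal V}\mathcal G^{\oplus T}$. (ii) If $\mathcal V$ is closed under pointwise maximum, then the max lift is valid with respect to $\mathcal V$: for every path-complete graph $\mathcal G$ on $\langle M\rangle$ satisfying the standing assumption, $\mathcal G\le_{\mathcal V}\mathcal G_{\max}$. (iii) If $\mathcal V$ is closed under pointwise minimum, then the min lift is valid with respect to $\mathcal V$: for every path-complete graph $\mathcal G$ on $\langle M\rangle$ satisfying the standing assumption, $\mathcal G\le_{\mathcal V}\mathcal G_{\min}$.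
   Context: Graphs. $\langle M\rangle:=\{1,\dots,M\}$. A graph on $\langle M\rangle$ is a pair $\mathcal G=(S,E)$ with $S$ a finite nonempty set of nodes and $E\subseteq S\times S\times\langle M\rangle$ a set of directed labeled edges; $(a,b,i)$ is an edge from $a$ to $b$ labeled $i$. $\mathcal G$ is path-complete if for every $K\ge1$ and every $(j_1,\dots,j_K)\in\langle M\rangle^K$ there are nodes $a_1,\dots,a_{K+1}$ with $(a_k,a_{k+1},j_k)\in E$ for $1\le k\le K$. Standing assumption on the graph $\mathcal G$ being lifted: $\mathcal G$ has one strongly connected component (it is strongly connected), and removing any edge from $\mathcal G$ destroys path-completeness. (The lifted graphs are not required to satisfy this.) Templates. $\mathcal C^0_+(\mathbb R^n,\mathbb R)$ is the set of continuous, positive definite, radially unbounded functions $\mathbb R^n\to\mathbb R$. A template is a family $\mathcal V=\bigcup_{n\ge1}\mathcal V_n$ with $\mathcal V_n\subseteq\mathcal C^0_+(\mathbb R^n,\mathbb R)$. It is closed under addition (resp. pointwise maximum, pointwise minimum) if for every $n$ and all $f_1,f_2\in\mathcal V_n$, $f_1+f_2\in\mathcal V_n$ (resp. $\max\{f_1,f_2\}\in\mathcal V_n$, $\min\{f_1,f_2\}\in\mathcal V_n$). Order relation. Given $F=(f_1,\dots,f_M)$ with $f_i:\mathbb R^n\to\mathbb R^n$ continuous and a path-complete graph $\mathcal G=(S,E)$, a collection $V=\{V_s\mid s\in S\}\subseteq\mathcal C^0_+(\mathbb R^n,\mathbb R)$ (indexed by $S$, repetitions allowed) is admissible for $\mathcal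 G$ and $F$, written $V\in PCLF(\mathcal G,F)$, if $V_b(f_i(x))\le V_a(x)$ for all $(a,b,i)\in E$ and all $x\in\mathbb R^n$. For path-complete graphs $\mathcal G,\widetilde{\mathcal G}$ on $\langle M\rangle$, $\mathcal G\le_{\mathcal V}\widetilde{\mathcal G}$ means: for every $n$ and every $M$-tuple $F$ of continuous maps $\mathbb R^n\to\mathbb R^n$, if there is $V\subseteq\mathcal V$ with $V\in PCLF(\mathcal G,F)$, then there is $W\subseteq\mathcal V$ with $W\in PCLF(\widetilde{\mathcal G},F)$. In particular the relation includes that both graphs are path-complete. Lifts of $\mathcal G=(S,E)$. - $T$-sum lift $\mathcal G^{\oplus T}=(S^{\oplus T},E^{\oplus T})$: $S^{\oplus T}$ is the set of multisets of cardinality $T$ with elements in $S$; for each label $i$ and each multiset of $T$ edges $\{(a_1,b_1,i),\dots,(a_T,b_T,i)\}$ of $E$ (all with label $i$, repetitions allowed), $(\{a_1,\dots,a_T\},\{b_1,\dots,b_T\},i)\in E^{\oplus T}$ (and these are all the edges). - Max lift $\mathcal G_{\max}$: nodes are the nonempty subsets of $S$; $(A,B,i)$ is an edge iff for all $b\in B$ there is $a\in A$ with $(a,b,i)\in E$. - Min lift $\mathcal G_{\min}$: nodes are the nonempty subsets of $S$; $(A,B,i)$ is an edge iff for all $a\in A$ there is $b\in B$ with $(a,b,i)\in E$. *)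

(* Defs.v *)
From HB Require Import structures.
From mathcomp Require Import all_boot all_order all_algebra finmap multiset.
From mathcomp Require Import all_classical all_reals topology normedtype.

Set Implicit Arguments.
Unset Strict Implicit.
Unset Printing Implicit Defensive.

Import Order.TTheory GRing.Theory Num.Theory numFieldNormedType.Exports.

Local Open Scope ring_scope.

(* The label set {1, ..., M} is rendered as 'I_M, i.e. {0, ..., M - 1}. *)
Record graph (M : nat) := Graph {
  node : finType;
  node_gt0 : (0 < #|node|)%N;
  edge : {set node * node * 'I_M}
}.

Section Graphs.
Variable M : nat.
Implicit Type G : graph M.

Definition path_complete G : Prop :=
  forall (K : nat) (j : 'I_K -> 'I_M), (0 < K)%N ->
  exists a : 'I_K.+1 -> node G,
    forall k : 'I_K,
      (a (widen_ord (leqnSn K) k), a (lift ord0 k), j k) \in edge G.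

Definition strongly_connected G : Prop :=
  forall a b : node G,
    connect [rel u v | [exists i : 'I_M, (u, v, i) \in edge G]] a b.

Definition remove_edge G (e : node G * node G * 'I_M) : graph M :=
  Graph (node_gt0 G) (edge G :\ e).

Definition edge_minimal G : Prop :=
  forall e, e \in edge G -> ~ path_complete (remove_edge e).

End Graphs.

Record multisets (T : nat) (X : finType) := Multisets {
  mset_of :> {mset X}%mset;
  size_mset_of : size mset_of == T
}.

Section MultisetsFinite.
Variables (T : nat) (X : finType).

HB.instance Definition _ := [isSub for @mset_of T X].
HB.instance Definition _ := [Choice of multisets T X by <:].

Definition tuple_of_multisets (A : multisets T X) : T.-tuple X :=
  Tuple (size_mset_of A).

Definition multisets_of_tuple (t : T.-tuple X) : option (multisets T X) :=
  insub (seq_mset t).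

Lemma tuple_of_multisetsK : pcancel tuple_of_multisets multisets_of_tuple.
Proof.
by move=> A; rewrite /multisets_of_tuple /= seq_mset_id; exact: (valK A).
Qed.

HB.instance Definition _ : isCountable (multisets T X) :=
  PCanIsCountable tuple_of_multisetsK.
HB.instance Definition _ : isFinite (multisets T X) :=
  PCanIsFinite tuple_of_multisetsK.

Lemma card_multisets_gt0 : (0 < #|X|)%N -> (0 < #|{: multisets T X}|)%N.
Proof.
case/card_gt0P => x _; apply/card_gt0P.
have sz : size (seq_mset (nseq T x)) == T.
  by rewrite (perm_size (perm_eq_seq_mset _)) size_nseq.
by exists (Multisets sz).
Qed.

End MultisetsFinite.

Definition nonempty_set (X : finType) : finType := {A : {set X} | A != finset.set0}.

Lemma card_nonempty_set_gt0 (X : finType) :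
  (0 < #|X|)%N -> (0 < #|nonempty_set X|)%N.
Proof.
case/card_gt0P => x _; apply/card_gt0P.
have nz : [set: X] != finset.set0 by apply/finset.set0Pn; exists x; rewrite inE.
by exists (exist (fun A : {set X} => A != finset.set0) _ nz).
Qed.

Section Lifts.
Variable M : nat.
Implicit Type G : graph M.

(* An edge of the T-sum lift comes from a multiset W of T edges of G with a   *)
(* common label; seq_mset forgets the order in which W happens to be          *)
(* enumerated.                                                                *)
Definition sum_lift (T : nat) G : graph M :=
  Graph (card_multisets_gt0 T (node_gt0 G))
    [set x : multisets T (node G) * multisets T (node G) * 'I_M |
      let: (A, B, i) := x in
      [exists W : multisets T (node G * node G * 'I_M)%type,
        [&& all (fun e => (e \in edge G) && (e.2 == i)) W,
            mset_of A == seq_mset [seq e.1.1 | e <- W]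
          & mset_of B == seq_mset [seq e.1.2 | e <- W]]]].

Definition max_lift G : graph M :=
  Graph (card_nonempty_set_gt0 (node_gt0 G))
    [set x : nonempty_set (node G) * nonempty_set (node G) * 'I_M |
      let: (A, B, i) := x in
      [forall b in val B, exists a in val A, (a, b, i) \in edge G]].

Definition min_lift G : graph M :=
  Graph (card_nonempty_set_gt0 (node_gt0 G))
    [set x : nonempty_set (node G) * nonempty_set (node G) * 'I_M |
      let: (A, B, i) := x in
      [forall a in val A, exists b in val B, (a, b, i) \in edge G]].

End Lifts.

Section Lyapunov.
Variable R : realType.

(* R^n is 'rV[R]_n; its library norm is the sup norm, which is equivalent to  *)
(* any other, so the choice affects neither continuity nor unboundedness.     *)
Definition positive_definite n (f : 'rV[R]_n -> R) : Prop :=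
  f 0 = 0 /\ forall x, x != 0 -> 0 < f x.

Definition radially_unbounded n (f : 'rV[R]_n -> R) : Prop :=
  forall c : R, exists r : R, forall x, r <= `|x| -> c <= f x.

Definition C0plus n (f : 'rV[R]_n -> R) : Prop :=
  [/\ continuous f, positive_definite f & radially_unbounded f].

(* Only the dimensions n >= 1 are meaningful: the component at n = 0 is       *)
(* unconstrained and never used.                                              *)
Record template := Template {
  tmpl :> forall n : nat, set ('rV[R]_n -> R);
  tmpl_C0plus : forall n (f : 'rV[R]_n -> R), (0 < n)%N -> tmpl f -> C0plus f
}.

Implicit Type V : template.

Definition closed_add V : Prop :=
  forall n (f1 f2 : 'rV[R]_n -> R), (0 < n)%N ->
    V n f1 -> V n f2 -> V n (f1 \+ f2).

Definition closed_max V : Prop :=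
  forall n (f1 f2 : 'rV[R]_n -> R), (0 < n)%N ->
    V n f1 -> V n f2 -> V n (f1 \max f2).

Definition closed_min V : Prop :=
  forall n (f1 f2 : 'rV[R]_n -> R), (0 < n)%N ->
    V n f1 -> V n f2 -> V n (f1 \min f2).

Variable M : nat.

Definition PCLF n (G : graph M) (F : 'I_M -> 'rV[R]_n -> 'rV[R]_n)
    (U : node G -> 'rV[R]_n -> R) : Prop :=
  (forall s, C0plus (U s)) /\
  forall a b i, (a, b, i) \in edge G -> forall x, U b (F i x) <= U a x.

Definition graph_le V (G G' : graph M) : Prop :=
  [/\ path_complete G, path_complete G' &
      forall n (F : 'I_M -> 'rV[R]_n -> 'rV[R]_n), (0 < n)%N ->
        (forall i, continuous (F i)) ->
        (exists U : node G -> 'rV[R]_n -> R,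
            (forall s, V n (U s)) /\ PCLF F U) ->
        exists W : node G' -> 'rV[R]_n -> R,
          (forall s, V n (W s)) /\ PCLF F W].

Definition valid_lift V (L : graph M -> graph M) : Prop :=
  forall G, path_complete G -> strongly_connected G -> edge_minimal G ->
    graph_le V G (L G).

End Lyapunov.

(* Main.v *)
Require Import Defs.
From mathcomp Require Import all_boot all_order all_algebra all_classical all_reals.
From mathcomp Require Import finmap multiset.

(** Each lift contains [G] as a subgraph (constant multisets for the sum lift,
    singletons for the max and min lifts), hence inherits path-completeness.
    An admissible family for [G] induces one for the lift by summing, resp.
    taking the maximum or minimum, over the elements of each lifted node. *)

Set Implicit Arguments.
Unset Strict Implicit.
Unset Printing Implicit Defensive.

Import Order.TTheory GRing.Theory Num.Theory.

Local Open Scope ring_scope.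

Lemma path_complete_hom (M : nat) (G G' : graph M) (h : node G -> node G') :
  (forall a b i, (a, b, i) \in edge G -> (h a, h b, i) \in edge G') ->
  path_complete G -> path_complete G'.
Proof.
move=> hE pcG K j K0; have [a aE] := pcG K j K0.
by exists (h \o a) => k; exact/hE/aE.
Qed.

(** Path-completeness passes to [G'] along the homomorphism [h], and [L] builds the family on [G']
    from [U] alone, independently of [F]. Membership in [C0plus] follows from membership in the
    template. *)
Lemma graph_le_hom (R : realType) (M : nat) (V : template R) (G G' : graph M)
    (h : node G -> node G')
    (L : forall n, (node G -> 'rV[R]_n -> R) -> node G' -> 'rV[R]_n -> R) :
  path_complete G ->
  (forall a b i, (a, b, i) \in edge G -> (h a, h b, i) \in edge G') ->
  (forall n U A, (0 < n)%N -> (forall s, V n (U s)) -> V n (L n U A)) ->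
  (forall n (F : 'I_M -> 'rV[R]_n -> 'rV[R]_n) U,
    (forall a b i, (a, b, i) \in edge G -> forall x, U b (F i x) <= U a x) ->
    forall A B i, (A, B, i) \in edge G' ->
      forall x, L n U B (F i x) <= L n U A x) ->
  graph_le V G G'.
Proof.
move=> pcG hE LV LE; split=> //; first exact: path_complete_hom hE pcG.
move=> n F n0 _ [U [UV [_ UE]]]; exists (L n U).
have LUV A : V n (L n U A) by exact: LV.
split=> //; split; last exact: LE.
by move=> A; exact: tmpl_C0plus (LUV A).
Qed.

(** Max and min have no neutral element in the reals, so the initial value [idx] is itself a member
    of [Q]; induction on [r] then never leaves [Q]. *)
Lemma closed_bigop (X Y I : Type) (op : Y -> Y -> Y) (Q : set (X -> Y))
    (idx : X -> Y) (U : I -> X -> Y) (r : seq I) (P : pred I) :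
  (forall f g, Q f -> Q g -> Q (fun x => op (f x) (g x))) ->
  Q idx -> (forall s, Q (U s)) ->
  Q (fun x => \big[op/idx x]_(s <- r | P s) U s x).
Proof.
move=> Qop Qidx QU; elim: r => [|s r IHr].
  by under eq_fun do rewrite big_nil.
under eq_fun do rewrite big_cons.
by case: (P s) => //; exact: Qop.
Qed.

(** The zero function is not positive definite, so it cannot start the induction inside a template;
    a one-term sum does, which is why [r] must be nonempty. *)
Lemma closed_sum (X I : Type) (Y : nmodType) (Q : set (X -> Y))
    (U : I -> X -> Y) (r : seq I) :
  (forall f g, Q f -> Q g -> Q (fun x => f x + g x)) ->
  (forall s, Q (U s)) -> (0 < size r)%N ->
  Q (fun x => \sum_(s <- r) U s x).
Proof.
move=> QD QU; case: r => // s r _; elim: r s => [|t r IHr] s.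
  by under eq_fun do rewrite big_seq1.
under eq_fun do rewrite big_cons.
exact: QD.
Qed.

Lemma sum_lift_valid (R : realType) (M T : nat) (V : template R) :
  (0 < T)%N -> closed_add V -> valid_lift V (@sum_lift M T).
Proof.
move=> T0 VD G pcG _ _.
have size_const (X : finType) (a : X) : size (seq_mset (nseq T a)) == T.
  by rewrite (perm_size (perm_eq_seq_mset _)) size_nseq.
pose const (X : finType) (a : X) := Multisets (size_const X a).
apply: (@graph_le_hom R M V G (sum_lift T G) (const (node G))
  (fun n U A x => \sum_(s <- mset_of A) U s x)) => //.
(* The witness is [T] copies of the edge [(a, b, i)]; its sources and targets are the constant
   multisets on [a] and [b]. *)
- move=> a b i abE; rewrite inE; apply/existsP; exists (const _ (a, b, i)).
  have perm_const := perm_eq_seq_mset (nseq T (a, b, i)).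
  apply/and3P; split.
  + rewrite (perm_all _ perm_const) all_nseq.
    by rewrite abE /= eqxx orbT.
  + apply/eqP/eq_seq_msetP; rewrite perm_sym.
    by apply: perm_trans (perm_map _ perm_const) _; rewrite map_nseq.
  + apply/eqP/eq_seq_msetP; rewrite perm_sym.
    by apply: perm_trans (perm_map _ perm_const) _; rewrite map_nseq.
- move=> n U A n0 UV; apply: closed_sum => //; last by rewrite (eqP (size_mset_of A)).
  by move=> f g; exact: VD.
- move=> n F U UE A B i; rewrite inE => /existsP[W /and3P[/allP WE /eqP-> /eqP->]] x.
  (* Both node sums become sums over the same edges [W], one through targets and one through
     sources, so they compare edge by edge. *)
  rewrite !(perm_big _ (perm_eq_seq_mset _)) /= !big_map.
  rewrite big_seq [leRHS]big_seq; apply: ler_sum => -[[a b] j] /WE /=.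
  by case/andP=> abE /eqP ji; apply: UE; rewrite -ji.
Qed.

Definition nonempty_set1 (X : finType) (a : X) : nonempty_set X :=
  exist (fun A : {set X} => A != finset.set0) (finset.set1 a)
    (introT (finset.set0Pn _) (ex_intro _ a (finset.set11 a))).

(** Supplies the initial value of the max or min over [A]; since it lies in [A], it does not change
    the result. *)
Definition nonempty_set_elt (X : finType) (A : nonempty_set X) : X :=
  xchoose (finset.set0Pn _ (valP A)).

Lemma nonempty_set_eltP (X : finType) (A : nonempty_set X) :
  nonempty_set_elt A \in val A.
Proof. exact: xchooseP. Qed.

(** Along an edge from [A] to [B], every [b] in [B] has a predecessor [a] in [A], so [U b] after
    [F i] is at most [U a], hence at most the maximum over [A]. *)
Lemma max_lift_valid (R : realType) (M : nat) (V : template R) :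
  closed_max V -> valid_lift V (@max_lift M).
Proof.
move=> VM G pcG _ _.
apply: (@graph_le_hom R M V G (max_lift G) (@nonempty_set1 (node G))
  (fun n U A x => \big[Num.max/U (nonempty_set_elt A) x]_(s in val A) U s x)) => //.
- move=> a b i abE; rewrite inE; apply/forall_inP => c /finset.set1P->.
  by apply/exists_inP; exists a; rewrite ?finset.set11.
- move=> n U A n0 UV; apply: closed_bigop => // f g; exact: VM.
- move=> n F U UE A B i; rewrite inE => /forall_inP ABE x.
  have UB b : b \in val B ->
      U b (F i x) <= \big[Num.max/U (nonempty_set_elt A) x]_(s in val A) U s x.
    move=> /ABE/exists_inP[a aA abE].
    by apply: le_trans (UE _ _ _ abE x) _; exact: le_bigmax_cond.
  (* The initial value must satisfy the bound too; it is [U] at an element of [B], so [UB] covers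
     it. *)
  by apply: bigmax_le => //; exact/UB/nonempty_set_eltP.
Qed.

(** Dually, every [a] in [A] has a successor [b] in [B], so the minimum over [B] after [F i] is at
    most each [U a]. *)
Lemma min_lift_valid (R : realType) (M : nat) (V : template R) :
  closed_min V -> valid_lift V (@min_lift M).
Proof.
move=> VM G pcG _ _.
apply: (@graph_le_hom R M V G (min_lift G) (@nonempty_set1 (node G))
  (fun n U A x => \big[Num.min/U (nonempty_set_elt A) x]_(s in val A) U s x)) => //.
- move=> a b i abE; rewrite inE; apply/forall_inP => c /finset.set1P->.
  by apply/exists_inP; exists b; rewrite ?finset.set11.
- move=> n U A n0 UV; apply: closed_bigop => // f g; exact: VM.
- move=> n F U UE A B i; rewrite inE => /forall_inP ABE x.
  have UA a : a \in val A ->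
      \big[Num.min/U (nonempty_set_elt B) (F i x)]_(s in val B) U s (F i x)
        <= U a x.
    move=> /ABE/exists_inP[b bB abE].
    by apply: le_trans (UE _ _ _ abE x); exact: bigmin_le_cond.
  by apply: le_bigmin => //; exact/UA/nonempty_set_eltP.
Qed.

Theorem theorem3 (R : realType) (M T : nat) (hM : (1 <= M)%N) (hT : (1 <= T)%N)
    (V : template R) :
  [/\ closed_add V -> valid_lift V (@sum_lift M T),
      closed_max V -> valid_lift V (@max_lift M)
    & closed_min V -> valid_lift V (@min_lift M)].
Proof.
split; first exact: sum_lift_valid.
- exact: max_lift_valid.
- exact: min_lift_valid.
Qed.
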